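(* Let $I$ be a set. For every $E\subseteq\mathcal P(I)$ such that $E$ is closed under supersets, there are $A\subseteq\mathcal P(I)$ and $B\subseteq\mathcal P(A)$ such that, for every topological space $X$, $X$ satisfies the $E$-accumulation property if and only if $X$ is $[B,A]$-compact.
   Context: $\mathcal P(I)$ is the set of all subsets of $I$; no separation axiom is assumed. $E\subseteq\mathcal P(I)$ is closed under supersets if, whenever $e\in E$ and $e\subseteq f\subseteq I$, then $f\in E$. For $E\subseteq\mathcal P(I)$ and an $I$-indexed sequence $(x_i)_{i\in I}$ of elements of $X$, a point $x\in X$ is an $E$-accumulation point of the sequence if $\{i\in I\mid x_i\in U\}\in E$ for every open neighborhood $U$ of $x$. $X$ satisfies the $E$-accumulation property if every $I$-indexed sequence of elements of $X$ has some (not necessarily unique) $E$-accumulation point. For a set $A$ and $B\subseteq\mathcal P(A)$, $X$ is $[B,A]$-compact if, whenever $(O_a)_{a\in A}$ is a sequence (indexed family) of open sets of $X$ with $\bigcup_{a\in A}O_a=X$, there is $H\in B$ such that $\bigcup_{a\in H}O_a=X$. *)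

(* Defs.v *)
From mathcomp Require Import all_boot.
From mathcomp Require Import boolp classical_sets filter topology.

Set Implicit Arguments.
Unset Strict Implicit.
Unset Printing Implicit Defensive.

Local Open Scope classical_set_scope.

Definition closed_under_supersets (I : Type) (E : set_system I) : Prop :=
  forall e f : set I, E e -> e `<=` f -> E f.

Definition accumulation_point (I : Type) (E : set_system I)
    (X : topologicalType) (x_ : I -> X) (x : X) : Prop :=
  forall U : set X, open_nbhs x U -> E [set i | U (x_ i)].

Definition accumulation_property (I : Type) (E : set_system I)
    (X : topologicalType) : Prop :=
  forall x_ : I -> X, exists x : X, accumulation_point E x_ x.

(* The index set of the cover is the subset A of T: a family indexed by A is
   the restriction to A of a function on T, whose values outside A play no
   role when B consists of subsets of A. *)
Definition BA_compact (T : Type) (B : set_system T) (A : set T)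
    (X : topologicalType) : Prop :=
  forall O : T -> set X,
    (forall a, A a -> open (O a)) -> \bigcup_(a in A) O a = setT ->
    exists2 H, B H & \bigcup_(a in H) O a = setT.

(* Main.v *)
Require Import Defs.
From mathcomp Require Import all_boot.
From mathcomp Require Import boolp classical_sets filter topology.

Local Open Scope classical_set_scope.

(** Take for [A] the complement of [E], and for [B] the subfamilies of [A]
    that do not cover [I]. The link between sequences and covers is the
    relation
      for all [a] in [A] and all [i], [x_ i] in [O a] implies [i] in [a].
    Suppose that it holds for a family of open sets [O] covering [X]. Then
    [x_] has no [E]-accumulation point: any point lies in some [O a], and the
    indices that [x_] sends into [O a] lie in [a], which is outside the
    superset-closed [E]. Also, no [H] in [B] gives a subcover: an index [i]
    missed by every member of [H] has [x_ i] outside every [O a] with [a] in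
    [H]. So it suffices to complete each datum to such a pair.
    - Given a sequence without accumulation point, let [O a] be the largest
      open set whose preimage under [x_] lies in [a]; these sets cover [X]
      because each point has an open neighborhood with preimage outside [E].
    - Given a cover without subcover indexed by a member of [B], choose [x_ i]
      outside every [O a] with [i] not in [a]; this is possible because those
      [a] all miss [i], hence form a member of [B]. *)

Definition noncovering (I : Type) (A : set_system I) : set_system (set I) :=
  [set H | H `<=` A /\ \bigcup_(a in H) a <> setT].

Lemma noncovering_avoiding (I : Type) (A : set_system I) (i : I) :
  noncovering I A [set a | A a /\ ~ a i].
Proof.
split=> [a [] //|coverI].
have [a [_ nai] ai] : (\bigcup_(a in [set a | A a /\ ~ a i]) a) i.
  by rewrite coverI.
exact: nai.
Qed.

(** The sequence is read off the cover: [x_ i] witnesses that the members of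
    the cover whose index misses [i] do not cover [X]. An accumulation point
    of it would put the index of a set containing that point into [E]. *)
Lemma accumulation_property_BA_compact (I : Type) (E : set_system I)
    (X : topologicalType) :
  closed_under_supersets E -> accumulation_property E X ->
  BA_compact (noncovering I (~` E)) (~` E) X.
Proof.
move=> Esup accX O openO coverO; apply: contrapT => noH.
have /choice[x_ x_P] (i : I) : exists x : X, forall a, ~ E a -> O a x -> a i.
  apply: contrapT => nox; apply: noH.
  exists [set a | (~` E) a /\ ~ a i]; first exact: noncovering_avoiding.
  rewrite -subTset => x _; apply: contrapT => nOx; apply: nox.
  exists x => a nEa Oax; apply: contrapT => nai.
  by apply: nOx; exists a.
have [x xacc] := accX x_.
have [a nEa Oax] : (\bigcup_(a in ~` E) O a) x by rewrite coverO.
apply: (nEa); apply: (Esup [set i | O a (x_ i)]).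
  by apply: xacc; split=> //; exact: openO.
by move=> i; exact: x_P.
Qed.

Lemma BA_compact_accumulation_property (I : Type) (E : set_system I)
    (X : topologicalType) :
  BA_compact (noncovering I (~` E)) (~` E) X -> accumulation_property E X.
Proof.
move=> compactX x_; apply: contrapT => noacc.
(* the largest open set with preimage contained in [a] *)
pose O (a : set I) := \bigcup_(U in [set U | open U /\ x_ @^-1` U `<=` a]) U.
have openO a : open (O a) by apply: bigcup_open => U [].
have [||H [_ HI] HX] := compactX O; first by move=> a _; exact: openO.
  rewrite -subTset => x _; apply: contrapT => nOx; apply: noacc.
  exists x => U [Uo Ux]; apply: contrapT => nEU; apply: nOx.
  by exists (x_ @^-1` U) => //; exists U => /=; first split.
apply: HI; rewrite -subTset => i _.
have [a Ha [U [_ Ua] Uxi]] : (\bigcup_(a in H) O a) (x_ i) by rewrite HX.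
by exists a => //; exact: Ua.
Qed.

Theorem corollary3p10 (I : Type) (E : set_system I)
    (hE : closed_under_supersets E) :
  exists (A : set_system I) (B : set_system (set I)),
    (forall H, B H -> H `<=` A) /\
    forall X : topologicalType,
      accumulation_property E X <-> BA_compact B A X.
Proof.
exists (~` E), (noncovering I (~` E)); split=> [H [] //|X]; split.
- exact: accumulation_property_BA_compact.
- exact: BA_compact_accumulation_property.
Qed.
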